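(* Let $A$ be a closed linear operator on $C_0(X)$, where $X$ is a locally compact metric space (endowed with a measure), or else on $L^q(X)$ for some $q\in[1,\infty]$ and some measure space $X$. Furthermore, let $\rho$ be a (measurable, nowhere vanishing) function on $X$. Then the following assertions hold for all eigenpairs $(\lambda,\varphi)$ of $A$. (1) Let, for some $\mu\in\mathbb{C}$, $\mu+A$ be invertible and let its inverse be an integral operator with integral kernel $q_\mu$. Then for all $r_1,r_2\in[1,\infty]$ such that $r_1^{-1}+r_2^{-1}=1$ we have $$|\varphi(x)|\le|\lambda+\mu|\left\|\frac{\varphi}{\rho}\right\|_{r_1}\left(\int_X|q_\mu(x,y)\rho(y)|^{r_2}\,dy\right)^{\frac1{r_2}}\qquad\text{for all (in the case of }C_0(X)\text{) / a.e. (in the case of } L^q(X)) \ x\in X,$$ provided both terms on the right-hand side are finite. (2) Let $-A$ generate a $C_0$-semigroup $(e^{-tA})_{t\ge 0}$ and let, for some $t_0>0$, $e^{-t_0A}$ be an integral operator with integral kernel $p_{t_0}$. Then for all $r_1,r_2\in[1,\infty]$ such that $r_1^{-1}+r_2^{-1}=1$ we have $$|\varphi(x)|\le e^{t_0\operatorname{Re}\lambda}\left\|\frac{\varphi}{\rho}\right\|_{r_1}\left(\int_X|p_{t_0}(x,y)\rho(y)|^{r_2}\,dy\right)^{\frac1{r_2}}\qquad\text{for all / a.e. }x\in X \text{ (respectively)},$$ provided both terms on the right-hand side are finite.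
   Context: An eigenpair of $A$ is $(\lambda,\varphi)$ with $\lambda\in\mathbb{C}$, $0\ne\varphi\in D(A)$, $A\varphi=\lambda\varphi$. An operator $T$ is an integral operator with kernel $k$ if $k$ is a measurable function on $X\times X$ such that for every $f$ in the space, $k(x,\cdot)f$ is integrable and $(Tf)(x)=\int_Xk(x,y)f(y)\,dy$ for all (for $C_0(X)$) or almost every (for $L^q(X)$) $x\in X$. Integrals and the norms $\|\cdot\|_{r}$ are with respect to the given measure on $X$; for $r_2=\infty$ the expression $(\int_X|g(y)|^{r_2}dy)^{1/r_2}$ is read as the essential supremum of $|g|$. *)

(* Defs.v *)
From HB Require Import structures.
From mathcomp Require Import all_boot all_order all_algebra.
From mathcomp Require Import generic_quotient ring_quotient.
From mathcomp Require Import all_classical all_reals all_analysis.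
From mathcomp Require Import measurable_realfun ess_sup_inf complex.

Set Implicit Arguments.
Unset Strict Implicit.
Unset Printing Implicit Defensive.
Import Order.TTheory GRing.Theory Num.Theory.
Import numFieldNormedType.Exports.
Import Normc.
Arguments normc {R} x.
Local Open Scope classical_set_scope.
Local Open Scope ring_scope.
Local Open Scope complex_scope.

Section ComplexModulus.
Context {R : realType}.
Implicit Types z w : R[i].

Lemma normr_normc z : `|z| = (normc z)%:C.
Proof. by []. Qed.

Lemma normc_ge0 z : 0 <= normc z.
Proof. by case: z => a b; exact: sqrtr_ge0. Qed.

Lemma normc_ReIm z : normc z = Num.sqrt (complex.Re z ^+ 2 + complex.Im z ^+ 2).
Proof. by case: z. Qed.

Lemma ReD z w : complex.Re (z + w) = complex.Re z + complex.Re w.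
Proof. by case: z; case: w. Qed.

Lemma ImD z w : complex.Im (z + w) = complex.Im z + complex.Im w.
Proof. by case: z; case: w. Qed.

Lemma ReM z w : complex.Re (z * w) =
  complex.Re z * complex.Re w - complex.Im z * complex.Im w.
Proof. by case: z; case: w. Qed.

Lemma ImM z w : complex.Im (z * w) =
  complex.Re z * complex.Im w + complex.Im z * complex.Re w.
Proof. by case: z; case: w. Qed.

Lemma normc_continuous : continuous (normc : R[i]^o -> R).
Proof.
move=> z; have zF := @nbhs_filter (R[i]^o) z.
apply/(@cvgrPdist_le _ _ _ (nbhs (z : R[i]^o)) zF) => e e0.
apply/nbhs_ballP; exists e%:C => [|w]; first by rewrite /= ltcR.
rewrite /ball/= -[_ < _]/(`|z - w| < e%:C).
rewrite normr_normc ltcR => /ltW; apply: le_trans.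
rewrite ler_norml lerNl opprB !lerBlDr; apply/andP; split.
  by rewrite -(normcN (z - w)) opprB; have := le_normcD (w - z) z; rewrite subrK.
by have := le_normcD (z - w) w; rewrite subrK.
Qed.

End ComplexModulus.

Section ComplexMeasurable.
Context d (T : measurableType d) (R : realType).
Implicit Type f : T -> R[i].

Definition cmeasurable f :=
  measurable_fun [set: T] (fun x => complex.Re (f x)) /\
  measurable_fun [set: T] (fun x => complex.Im (f x)).

Lemma cmeasurable0 : cmeasurable (fun=> 0).
Proof. by split; exact: measurable_cst. Qed.

Lemma cmeasurableD f g : cmeasurable f -> cmeasurable g ->
  cmeasurable (fun x => f x + g x).
Proof.
move=> [fr fi] [gr gi]; split.
- rewrite (_ : (fun _ => _) = (fun x => complex.Re (f x) + complex.Re (g x))).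
    exact: measurable_funD.
  by apply/funext => x; rewrite ReD.
- rewrite (_ : (fun _ => _) = (fun x => complex.Im (f x) + complex.Im (g x))).
    exact: measurable_funD.
  by apply/funext => x; rewrite ImD.
Qed.

Lemma cmeasurableM f g : cmeasurable f -> cmeasurable g ->
  cmeasurable (fun x => f x * g x).
Proof.
move=> [fr fi] [gr gi]; split.
- rewrite (_ : (fun _ => _) = (fun x => complex.Re (f x) * complex.Re (g x)
      - complex.Im (f x) * complex.Im (g x))); last first.
    by apply/funext => x; rewrite ReM.
  by apply: measurable_funB; exact: measurable_funM.
- rewrite (_ : (fun _ => _) = (fun x => complex.Re (f x) * complex.Im (g x)
      + complex.Im (f x) * complex.Re (g x))); last first.
    by apply/funext => x; rewrite ImM.
  by apply: measurable_funD; exact: measurable_funM.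
Qed.

Lemma measurable_normc f : cmeasurable f ->
  measurable_fun [set: T] (fun x => normc (f x)).
Proof.
move=> [fr fi].
under eq_fun do rewrite normc_ReIm.
apply: measurableT_comp.
  by apply: continuous_measurable_fun; exact: sqrt_continuous.
by apply: measurable_funD; exact: measurable_funX.
Qed.

End ComplexMeasurable.

Section ComplexIntegration.
Context d (T : measurableType d) (R : realType).
Variable mu : {measure set T -> \bar R}.
Implicit Type f : T -> R[i].

Definition cintegrable f :=
  mu.-integrable [set: T] (fun x => (complex.Re (f x))%:E) /\
  mu.-integrable [set: T] (fun x => (complex.Im (f x))%:E).

Definition cintegral f : R[i] :=
  (\int[mu]_x complex.Re (f x)) +i* (\int[mu]_x complex.Im (f x)).

Definition cLnorm (p : \bar R) f : \bar R :=
  Lnorm mu p (fun x => (normc (f x))%:E).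

Local Open Scope ereal_scope.

Lemma cLnorm_ae_le p f g : 1 <= p -> cmeasurable f -> cmeasurable g ->
  {ae mu, forall x, (normc (f x) <= normc (g x))%R} ->
  cLnorm p f <= cLnorm p g.
Proof.
move=> p1 /measurable_normc mf /measurable_normc mg fg.
rewrite /cLnorm unlock; case: p p1 => //[r|_]; last first.
  case: ifP => // _; apply: le_ess_sup; apply: filterS fg => x fgx /=.
  by rewrite lee_fin !ger0_norm ?normc_ge0.
rewrite lee_fin => r1; have r0 : (0 <= r)%R by rewrite (le_trans _ r1).
have mpow (h : T -> R) : measurable_fun [set: T] h ->
    measurable_fun [set: T] (fun x => `|(h x)%:E| `^ r).
  move=> mh; apply/measurable_EFinP.
  apply: (@measurableT_comp _ _ _ _ _ _ (@powR R ^~ r)) => //.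
  exact: measurableT_comp.
apply: gt0_ler_poweR; rewrite ?in_itv/= ?leey ?andbT ?invr_ge0//.
- by apply: integral_ge0 => x _; rewrite lee_fin powR_ge0.
- by apply: integral_ge0 => x _; rewrite lee_fin powR_ge0.
- apply: ae_ge0_le_integral => //; try exact: mpow.
  apply: filterS fg => x fgx _; rewrite lee_fin.
  by apply: ge0_ler_powR => //; rewrite ?nnegrE// !ger0_norm ?normc_ge0.
Qed.

Lemma cLnorm_ge0 p f : 0 <= cLnorm p f.
Proof. exact: Lnorm_ge0. Qed.

Lemma cLnorm0 p : 1 <= p -> cLnorm p (fun=> 0%R) = 0.
Proof.
move=> p1; rewrite /cLnorm (_ : (fun _ => _) = cst 0).
  by rewrite Lnorm0// gt_eqF// (lt_le_trans _ p1).
by apply/funext => x; rewrite normc0.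
Qed.

Lemma cLnorm_ae_eq0 p f : 1 <= p -> cmeasurable f ->
  f = cst 0%R %[ae mu] -> cLnorm p f = 0.
Proof.
move=> p1 mf f0; apply/eqP; rewrite eq_le cLnorm_ge0 andbT -(cLnorm0 p1).
apply: cLnorm_ae_le => //.
by apply: filterS f0 => x /(_ I) ->.
Qed.

Lemma cLnorm_eq0 p f : 1 <= p -> cmeasurable f ->
  cLnorm p f = 0 -> f = cst 0%R %[ae mu].
Proof.
move=> p1 /measurable_normc mf /Lnorm_eq0_eq0 H.
have /H{}H : measurable_fun [set: T] (fun x => (normc (f x))%:E).
  exact/measurable_EFinP.
have := H (lt_le_trans lte01 p1); apply: filterS => x /(_ I) [] fx0 _.
exact: eq0_normc.
Qed.

Lemma cLnormD p f g : 1 <= p -> cmeasurable f -> cmeasurable g ->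
  cLnorm p (fun x => f x + g x)%R <= cLnorm p f + cLnorm p g.
Proof.
move=> p1 mf mg.
have mf' := measurable_normc mf; have mg' := measurable_normc mg.
apply: le_trans (eminkowski mu mf' mg' p1).
pose h x := ((normc (f x) + normc (g x))%R%:C)%C.
have hE x : normc (h x) = (normc (f x) + normc (g x))%R.
  by rewrite /h /= expr0n addr0 sqrtr_sqr ger0_norm ?addr_ge0 ?normc_ge0.
rewrite [leRHS](_ : _ = cLnorm p h).
  apply: cLnorm_ae_le => //; first exact: cmeasurableD.
    split; first exact: measurable_funD.
    exact: measurable_cst.
  by apply: aeW => x; rewrite hE; exact: le_normcD.
by congr (Lnorm mu p); apply/funext => x; exact: (congr1 EFin (esym (hE x))).
Qed.

Lemma cLnormZ p (a : R[i]) f : 1 <= p -> cmeasurable f -> cLnorm p f < +oo ->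
  cLnorm p (fun x => a * f x)%R = (normc a)%:E * cLnorm p f.
Proof.
move=> p1 mf fp.
pose g : T -> R := fun x => normc (f x).
have gL : g \in Lfun mu p.
  by apply/andP; split; rewrite inE//=; exact: measurable_normc.
have := @LnormZ _ _ _ mu p p1 (Lfun_Sub p1 gL) (normc a).
rewrite ger0_norm ?normc_ge0// /cLnorm => <-.
by apply: eq_Lnorm => x /=; rewrite normcM.
Qed.

End ComplexIntegration.

Section ContinuousVanishing.
Context (X : topologicalType) (R : realType).
Local Notation C := (R[i]^o).

Definition continuous_vanishing : {pred X -> C} :=
  mem [set f : X -> C | continuous f /\
    forall e : R, 0 < e ->
      exists2 K, compact K & forall x, ~ K x -> normc (f x) < e].

Lemma continuous_vanishing_submod : submod_closed continuous_vanishing.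
Proof.
split.
  rewrite inE; split; first exact: cst_continuous.
  by move=> e e0; exists set0; [exact: compact0|move=> x _; rewrite normc0].
move=> a f g /[!inE] -[cf vf] [cg vg]; split.
  move=> x; apply: cvgD; last exact: cg.
  by apply: cvgZr; exact: cf.
move=> e e0.
have e2 : 0 < e / 2 by rewrite divr_gt0.
have na : 0 < normc a + 1 by rewrite ltr_wpDl ?normc_ge0.
have [K cK Kf] := vf (e / 2 / (normc a + 1)) (divr_gt0 e2 na).
have [L cL Lg] := vg _ e2.
exists (K `|` L); first exact: compactU.
move=> x /not_orP[/Kf fx /Lg gx].
apply: le_lt_trans (le_normcD _ _) _.
rewrite [e]splitr ler_ltD//; last first.
rewrite -[X in normc X]/(a * f x) normcM.
apply: (@le_trans _ _ ((normc a + 1) * normc (f x))).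
  by rewrite ler_wpM2r ?normc_ge0// lerDl.
by rewrite mulrC -ler_pdivlMr// ltW.
Qed.

HB.instance Definition _ := GRing.isSubmodClosed.Build R[i] (X -> C)
  continuous_vanishing continuous_vanishing_submod.

Record C0 := MkC0 { C0_fun :> X -> C ; _ : C0_fun \in continuous_vanishing }.

HB.instance Definition _ := [isSub for C0_fun].
HB.instance Definition _ := [Choice of C0 by <:].
HB.instance Definition _ := [SubChoice_isSubLmodule of C0 by <:].

End ContinuousVanishing.

Section ContinuousVanishingNorm.
Context (X : topologicalType) (R : realType).
Implicit Type f : C0 X R.

Definition supnorm f : R := sup (range (fun x => normc (f x))).

Lemma C0_bounded f : has_ubound (range (fun x => normc (f x))).
Proof.
have := valP f; rewrite inE => -[cf vf].
have [K cK Kf] := vf 1 ltr01.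
have /compact_bounded/pinfty_ex_gt0[M _ MK] :
    compact ((fun x => normc (f x)) @` K).
  apply: continuous_compact => //; apply: continuous_subspaceT => x.
  by apply: continuous_comp; [exact: cf|exact: normc_continuous].
exists (Num.max 1 M) => _ [x _ <-].
have [Kx|nKx] := pselect (K x); last by rewrite le_max ltW// Kf.
have /= := MK _ (imageP (fun x => normc (f x)) Kx).
by rewrite ger0_norm ?normc_ge0// le_max => ->; rewrite orbT.
Qed.

Lemma supnorm_ge f x : normc (f x) <= supnorm f.
Proof. by apply: ub_le_sup; [exact: C0_bounded|exists x]. Qed.

Lemma supnorm_le f (M : R) : 0 <= M -> (forall x, normc (f x) <= M) ->
  supnorm f <= M.
Proof.
move=> M0 fM; have [[x _]|nX] := pselect (exists x : X, True).
  by apply: ge_sup; [exists (normc (f x)); exists x|move=> _ [y _ <-]].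
rewrite /supnorm [X in sup X](_ : _ = set0) ?sup0//.
by rewrite -subset0 => y [x _ _]; apply: nX; exists x.
Qed.

Lemma supnorm_ge0 f : 0 <= supnorm f.
Proof.
have [[x _]|nX] := pselect (exists x : X, True).
  exact: le_trans (normc_ge0 _) (supnorm_ge f x).
rewrite /supnorm [X in sup X](_ : _ = set0) ?sup0//.
by rewrite -subset0 => y [x _ _]; apply: nX; exists x.
Qed.

Let norm f : R[i] := (supnorm f)%:C.

Let normD f g : norm (f + g) <= norm f + norm g.
Proof.
rewrite -rmorphD lecR; apply: supnorm_le; first by rewrite addr_ge0 ?supnorm_ge0.
move=> x; apply: le_trans (le_normcD _ _) _.
by rewrite lerD// supnorm_ge.
Qed.

Let norm_eq0 f : norm f = 0 -> f = 0.
Proof.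
move=> /(congr1 (@complex.Re R))/= f0; apply/val_inj/funext => x /=.
by apply/eq0_normc/eqP; rewrite eq_le normc_ge0 andbT -f0 supnorm_ge.
Qed.

Let supnormZ_le (a : R[i]) f : supnorm (a *: f) <= normc a * supnorm f.
Proof.
apply: supnorm_le; first by rewrite mulr_ge0 ?normc_ge0 ?supnorm_ge0.
move=> x; rewrite -[X in normc X]/(a * f x) normcM.
by rewrite ler_wpM2l ?normc_ge0 ?supnorm_ge.
Qed.

Let normZ (a : R[i]) f : norm (a *: f) = `|a| * norm f.
Proof.
rewrite normr_normc -rmorphM; congr (_%:C); apply/eqP; rewrite eq_le supnormZ_le/=.
have [->|a0] := eqVneq a 0; first by rewrite normc0 mul0r supnorm_ge0.
have na : 0 < normc a.
  rewrite lt_neqAle normc_ge0 andbT eq_sym.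
  by apply: contra a0 => /eqP/eq0_normc->.
rewrite mulrC -ler_pdivlMr// mulrC -normcV.
by have := supnormZ_le a^-1 (a *: f); rewrite scalerA mulVf// scale1r.
Qed.

HB.instance Definition _ :=
  Lmodule_isNormed.Build R[i] (C0 X R) normD normZ norm_eq0.

End ContinuousVanishingNorm.

Section ComplexLp.
Context d (T : measurableType d) (R : realType).
Variables (mu : {measure set T -> \bar R}) (p : \bar R).
Local Notation C := (R[i]^o).

Definition cLfun_pred : {pred T -> C} :=
  mem [set f : T -> C | cmeasurable f /\ (cLnorm mu p f < +oo)%E].

Hypothesis p1 : (1 <= p)%E.

Lemma cLfun_submod : submod_closed cLfun_pred.
Proof.
split.
  by rewrite inE; split; [exact: cmeasurable0|rewrite cLnorm0].
move=> a f g /[!inE] -[mf fp] [mg gp].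
have maf : cmeasurable (fun x => (a : R[i]) * f x).
  by apply: cmeasurableM => //; split; exact: measurable_cst.
split; first exact: (cmeasurableD maf mg).
apply: le_lt_trans (cLnormD mu p1 maf mg) _.
rewrite lte_add_pinfty// cLnormZ//.
by rewrite lte_mul_pinfty ?lee_fin ?normc_ge0.
Qed.

End ComplexLp.

Section ComplexLfun.
Context d (T : measurableType d) (R : realType).
Variables (mu : {measure set T -> \bar R}) (p : \bar R) (p1 : (1 <= p)%E).
Local Notation C := (R[i]^o).

Record cLfun (p1 : (1 <= p)%E) :=
  MkcLfun { cLfun_fun :> T -> C ; _ : cLfun_fun \in cLfun_pred mu p }.

HB.instance Definition _ := [isSub for @cLfun_fun p1].
HB.instance Definition _ := [Choice of cLfun p1 by <:].
HB.instance Definition _ := GRing.SubChoice_isSubLmodule.Build _ _ _ (cLfun p1)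
  (cLfun_submod mu p1).

Lemma cLfun_measurable (f : cLfun p1) : cmeasurable f.
Proof. by have := valP f; rewrite inE => -[]. Qed.

Lemma cLfun_finite (f : cLfun p1) : (cLnorm mu p f < +oo)%E.
Proof. by have := valP f; rewrite inE => -[]. Qed.

Definition ae_zero : {pred cLfun p1} :=
  mem [set f : cLfun p1 | f = cst 0 %[ae mu]].

Lemma ae_zero_zmod : zmod_closed ae_zero.
Proof.
split; first by rewrite inE; apply: aeW.
move=> f g; rewrite !inE => f0 g0; apply: filterS2 f0 g0 => x fx gx _.
by rewrite -[LHS]/(f x - g x) (fx I) (gx I) subr0.
Qed.

HB.instance Definition _ :=
  GRing.isZmodClosed.Build (cLfun p1) ae_zero ae_zero_zmod.

Definition cLp := Quotient.quot ae_zero.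

HB.instance Definition _ := GRing.Zmodule.on cLp.
HB.instance Definition _ := EqQuotient.on cLp.

(* A representative of the class [u]; only its values up to [mu]-null sets are
   determined by [u]. *)
Definition cLp_fun (u : cLp) : T -> C := repr u.

End ComplexLfun.
Coercion cLp_fun : cLp >-> Funclass.

Section ComplexLpNormed.
Context d (T : measurableType d) (R : realType).
Variables (mu : {measure set T -> \bar R}) (p : \bar R) (p1 : (1 <= p)%E).
Local Notation L := (cLfun mu p1).
Local Notation Lp := (cLp mu p1).
Local Open Scope quotient_scope.
Implicit Types (f g : L) (u v : Lp).

Lemma cLp_eqP f g :
  reflect (f = g %[ae mu]) (\pi_Lp f == \pi_Lp g).
Proof.
rewrite -Quotient.idealrBE.
apply: (iffP idP); rewrite inE => fg; apply: filterS fg => x /(_ I) fgx _ /=.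
- by apply/eqP; rewrite -subr_eq0; apply/eqP.
- by rewrite -[LHS]/(f x - g x) fgx subrr.
Qed.

Lemma cLp_fun_pi f : cLp_fun (\pi_Lp f) = f %[ae mu].
Proof. by apply/cLp_eqP; rewrite reprK. Qed.

Lemma cLp_ext u v : cLp_fun u = v %[ae mu] -> u = v.
Proof. by move=> uv; rewrite -[u]reprK -[v]reprK; apply/eqP/cLp_eqP. Qed.

Definition cLp_scale (a : R[i]) u : Lp := \pi_Lp (a *: (repr u : L)).

Lemma cLp_scale_pi a f : cLp_scale a (\pi_Lp f) = \pi_Lp (a *: f).
Proof.
apply/eqP/cLp_eqP; apply: filterS (cLp_fun_pi f) => x /(_ I) fx _.
by rewrite -[LHS]/(a * cLp_fun (\pi_Lp f) x) fx.
Qed.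

Let scalerA' a b u : cLp_scale a (cLp_scale b u) = cLp_scale (a * b) u.
Proof.
by elim/quotW: u => f; rewrite (cLp_scale_pi b f) !cLp_scale_pi scalerA.
Qed.

Let scale1r' : left_id 1 cLp_scale.
Proof. by elim/quotW => f; rewrite cLp_scale_pi scale1r. Qed.

Let piD f g : \pi_Lp (f + g) = (\pi_Lp f + \pi_Lp g).
Proof. exact: Quotient.pi_add. Qed.

Let scalerDr' : right_distributive cLp_scale +%R.
Proof.
move=> a; elim/quotW=> f; elim/quotW=> g.
by rewrite -piD !cLp_scale_pi scalerDr piD.
Qed.

Let scalerDl' v : {morph cLp_scale^~ v : a b / a + b}.
Proof.
by move=> a b; elim/quotW: v => f; rewrite !cLp_scale_pi scalerDl piD.
Qed.

HB.instance Definition _ := GRing.Zmodule_isLmodule.Build R[i] Lp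
  scalerA' scale1r' scalerDr' scalerDl'.

Definition cLp_norm u : R[i] := (fine (cLnorm mu p u))%:C.

Let cLfun_normE f : (fine (cLnorm mu p f))%:E = cLnorm mu p f.
Proof. by rewrite fineK// ge0_fin_numE ?cLnorm_ge0// cLfun_finite. Qed.

Let cLp_norm_pi f : cLp_norm (\pi_Lp f) = (fine (cLnorm mu p f))%:C.
Proof.
congr (fine _)%:C; apply/eqP; rewrite eq_le; apply/andP; split;
  apply: cLnorm_ae_le => //; try exact: cLfun_measurable;
  by apply: filterS (cLp_fun_pi f) => x /(_ I) ->.
Qed.

Let cLp_normD u v : cLp_norm (u + v) <= cLp_norm u + cLp_norm v.
Proof.
elim/quotW: u => f; elim/quotW: v => g.
rewrite -piD !cLp_norm_pi -rmorphD lecR.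
by rewrite -lee_fin EFinD !cLfun_normE cLnormD//; exact: cLfun_measurable.
Qed.

Let cLp_normZ (a : R[i]) u : cLp_norm (a *: u) = `|a| * cLp_norm u.
Proof.
elim/quotW: u => f; rewrite [a *: _]cLp_scale_pi !cLp_norm_pi normr_normc -rmorphM.
congr (_%:C); apply: EFin_inj; rewrite EFinM !cLfun_normE.
by rewrite -cLnormZ//; [exact: cLfun_measurable|exact: cLfun_finite].
Qed.

Let cLp_norm_eq0 u : cLp_norm u = 0 -> u = 0.
Proof.
move=> /(congr1 (@complex.Re R))/= f0; apply: cLp_ext.
have /cLnorm_eq0 : cLnorm mu p (repr u) = 0%E by rewrite -cLfun_normE f0.
move=> /(_ p1 (cLfun_measurable _)) u0.
have z0 : cLp_fun (0 : Lp) = cst 0 %[ae mu].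
  have -> : (0 : Lp) = \pi_Lp (0 : L).
    by apply: (addrI (\pi_Lp (0 : L))); rewrite addr0 -piD addr0.
  exact: cLp_fun_pi.
by apply: filterS2 u0 z0 => x ux zx _; exact: etrans (ux I) (esym (zx I)).
Qed.

HB.instance Definition _ :=
  Lmodule_isNormed.Build R[i] Lp cLp_normD cLp_normZ cLp_norm_eq0.

End ComplexLpNormed.

Section Operators.
Context (R : realType) (V : normedModType R[i]).

(* Only the values of [opfun] on [dom] are meaningful. *)
Record operator := Operator { dom : set V ; opfun :> V -> V }.

Implicit Type A : operator.

Definition graph A : set (V * V) := [set uv | dom A uv.1 /\ A uv.1 = uv.2].

Definition linear_operator A :=
  dom A 0 /\ forall (a : R[i]) u v, dom A u -> dom A v ->
    dom A (a *: u + v) /\ A (a *: u + v) = a *: A u + A v.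

Definition closed_operator A := linear_operator A /\ closed (graph A).

Definition eigenpair A (lambda : R[i]) (u : V) :=
  [/\ u != 0, dom A u & A u = lambda *: u].

Definition op_opp A := Operator (dom A) (fun u => - A u).

Definition op_shift (z : R[i]) A := Operator (dom A) (fun u => z *: u + A u).

(* [A] is a bijection from its domain onto [V], with inverse [B].  When [A] is
   closed and [V] is a Banach space, [B] is automatically linear and bounded. *)
Definition op_inverse A (B : V -> V) :=
  (forall v, dom A (B v) /\ A (B v) = v) /\ (forall u, dom A u -> B (A u) = u).

(* Strong continuity as in Engel and Nagel: all orbits are continuous on
   [0, +oo[.  The values [S t] for [t < 0] are irrelevant. *)
Definition C0_semigroup (S : R -> V -> V) :=
  [/\ forall t, 0 <= t -> linear (S t) /\ continuous (S t),
      forall u, S 0 u = u,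
      forall s t u, 0 <= s -> 0 <= t -> S (s + t) u = S s (S t u) &
      forall u, {within `[0, +oo[, continuous (fun t => S t u)}].

Definition generates A (S : R -> V -> V) :=
  C0_semigroup S /\ forall u v, graph A (u, v) <->
    (h^-1)%:C *: (S h u - u) @[h --> (0 : R)^'+] --> v.

End Operators.

#[short(type="measurableMetricType")]
HB.structure Definition MeasurableMetric (d : measure_display)
    (R : numDomainType) :=
  { X of Measurable d X & Metric R X }.

Definition C0_integral_operator (d : measure_display) (R : realType)
    (X : measurableMetricType d R) (m : {measure set X -> \bar R})
    (B : C0 X R -> C0 X R) (k : X * X -> R[i]) :=
  cmeasurable k /\
  forall (f : C0 X R) x, cintegrable m (fun y => k (x, y) * f y) /\
    B f x = cintegral m (fun y => k (x, y) * f y).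

Definition Lp_integral_operator (d : measure_display) (R : realType)
    (X : measurableType d) (m : {measure set X -> \bar R})
    (q : \bar R) (q1 : (1 <= q)%E) (B : cLp m q1 -> cLp m q1)
    (k : X * X -> R[i]) :=
  cmeasurable k /\
  forall f : cLp m q1, {ae m, forall x,
    cintegrable m (fun y => k (x, y) * f y) /\
    B f x = cintegral m (fun y => k (x, y) * f y)}.

(* Main.v *)
(* An eigenvector [phi] is a fixed point [phi = K (b *: phi)] of a multiple of
   the integral operator [K]: with [b = lambda + mu] for the resolvent, and with
   [b = e^(t0 lambda)] for the semigroup, since [e^(t lambda) S t phi] is
   continuous in [t] with right derivative [0], hence constant.  Writing
   [k (x, y) phi y = (phi y / rho y) (k (x, y) rho y)] and applying Hoelder's
   inequality to the integral that represents [phi x] gives the bound. *)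
Require Import Defs.
From HB Require Import structures.
From mathcomp Require Import all_boot all_order all_algebra.
From mathcomp Require Import all_classical all_reals all_analysis.
From mathcomp Require Import complex.
From mathcomp Require Import measurable_realfun ess_sup_inf ring.
Set Implicit Arguments.
Unset Strict Implicit.
Import Order.TTheory GRing.Theory Num.Theory.
Import numFieldNormedType.Exports.
Import Normc.
Local Open Scope classical_set_scope.
Local Open Scope ring_scope.

(** * The complex modulus against real and imaginary parts *)

Section Modulus.
Context {R : realType}.
Implicit Types z w : R[i].

Lemma normr_Re_le_normc z : `|complex.Re z| <= normc z.
Proof.
by rewrite normc_ReIm -sqrtr_sqr ler_wsqrtr// lerDl sqr_ge0.
Qed.

Lemma normr_Im_le_normc z : `|complex.Im z| <= normc z.
Proof.
by rewrite normc_ReIm -sqrtr_sqr ler_wsqrtr// lerDr sqr_ge0.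
Qed.

Lemma normc_leD z : normc z <= `|complex.Re z| + `|complex.Im z|.
Proof.
rewrite normc_ReIm -[leRHS]ger0_norm ?addr_ge0// -sqrtr_sqr ler_wsqrtr//.
by rewrite sqrrD !real_normK ?num_real// -addrA lerD2l lerDr mulrn_wge0// mulr_ge0.
Qed.

Lemma normc_conjc z : normc z^*%C = normc z.
Proof. by case: z => a b /=; rewrite sqrrN. Qed.

End Modulus.

(** * Integrals of complex-valued functions *)

Section ComplexMeasure.
Context d (T : measurableType d) (R : realType).
Implicit Types f g : T -> R[i].

Variable mu : {measure set T -> \bar R}.

Lemma cintegrable_cmeasurable f : cintegrable mu f -> cmeasurable f.
Proof.
by move=> [/measurable_int/measurable_EFinP fr /measurable_int/measurable_EFinP].
Qed.

(** The modulus is dominated by the sum of the absolute values of the real and imaginary parts, both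
    integrable. *)
Lemma cintegrable_normc f : cintegrable mu f ->
  mu.-integrable [set: T] (EFin \o (fun x => normc (f x))).
Proof.
move=> fI; have [fr fi] := fI.
have iD := integrableD measurableT (integrable_abse fr) (integrable_abse fi).
apply: (le_integrable measurableT _ _ iD).
  apply/measurable_EFinP; apply: measurable_normc.
  exact: cintegrable_cmeasurable.
move=> x _ /=; rewrite lee_fin ger0_norm ?normc_ge0// ger0_norm ?addr_ge0//.
exact: normc_leD.
Qed.

(* Multiplying [f] by the conjugate of its integral makes that integral real. *)
Lemma normc_cintegral_le f : cintegrable mu f ->
  normc (cintegral mu f) <= \int[mu]_x normc (f x).
Proof.
move=> fI; have [fr fi] := fI; set I := cintegral mu f.
have [->|I0] := eqVneq (normc I) 0.
  by apply: Rintegral_ge0 => x _; exact: normc_ge0.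
have Igt0 : 0 < normc I by rewrite lt_neqAle eq_sym I0 normc_ge0.
rewrite -(ler_pM2l Igt0).
have iZ (a : R) (g : T -> R) : mu.-integrable [set: T] (EFin \o g) ->
    mu.-integrable [set: T] (EFin \o (fun x => a * g x)).
  by move=> gi; have := integrableZl measurableT a gi.
(* The integrand is [Re I * Re (f x) + Im I * Im (f x)], and its integral is the sum of the squares
   of [Re I] and [Im I]. *)
have -> : normc I * normc I = \int[mu]_x complex.Re (I^*%C * f x).
  transitivity (\int[mu]_x (complex.Re I * complex.Re (f x) +
                            complex.Im I * complex.Im (f x))).
    rewrite RintegralD//; [|exact: iZ|exact: iZ].
    rewrite !RintegralZl// -expr2 normc_ReIm sqr_sqrtr ?addr_ge0 ?sqr_ge0//.
  by apply: eq_Rintegral => x _; case: I I0 Igt0 => a b _ _; case: (f x) => u v /=;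
    rewrite mulNr opprK.
rewrite -RintegralZl//; last exact: cintegrable_normc.
apply: le_Rintegral => //.
- have -> : EFin \o (fun x => complex.Re (I^*%C * f x)) =
    (fun x => (complex.Re I * complex.Re (f x))%:E +
              (complex.Im I * complex.Im (f x))%:E)%E.
    apply/funext => x /=; rewrite -EFinD; congr EFin.
    by case: I I0 Igt0 => a b _ _; case: (f x) => u v /=; rewrite mulNr opprK.
  by apply: integrableD => //; exact: iZ.
- by apply: iZ; exact: cintegrable_normc.
move=> x _; rewrite -(normc_conjc I) -normcM.
exact: le_trans (ler_norm _) (normr_Re_le_normc _).
Qed.

End ComplexMeasure.

(** * Hoelder's inequality for conjugate exponents in [[1, +oo]] *)

Section Hoelder.
Context d (T : measurableType d) (R : realType).
Variable mu : {measure set T -> \bar R}.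
Local Open Scope ereal_scope.
Implicit Types f g : T -> R.

(** Almost everywhere [|g|] is at most its essential supremum, which then comes out of the
    integral. *)
Lemma hoelder1y f g : measurable_fun [set: T] f -> measurable_fun [set: T] g ->
  Lnorm mu 1 (EFin \o (f \* g)%R) <=
  Lnorm mu 1 (EFin \o f) * Lnorm mu +oo (EFin \o g).
Proof.
move=> mf mg; rewrite !Lnorm1 unlock.
(* On a space of measure [0] the norm of exponent [+oo] is [0] by convention; the integral on the
   left then vanishes too. *)
have [mu0|] := ltP; last first.
  rewrite le_eqVlt ltNge measure_ge0 orbF => /eqP mu0.
  rewrite mule0 integral_abs_eq0 //.
  by apply: measurableT_comp => //; exact: measurable_funM.
set M := ess_sup _ _.
have M0 : 0 <= M by apply: ess_sup_gee => //=; exact: aeW.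
rewrite muleC -ge0_integralZl//; last first.
  by do 2 apply: measurableT_comp => //.
apply: ae_ge0_le_integral => //.
- by do 2 apply: measurableT_comp => //; exact: measurable_funM.
- by move=> x _; rewrite mule_ge0.
- apply: emeasurable_funM => //.
  by do 2 apply: measurableT_comp => //.
apply: filterS (ess_sup_ge mu (abse \o (EFin \o g))) => x gM _ /=.
rewrite -abse_EFin EFinM abseM muleC lee_wpmul2r//.
Qed.

(** Finite exponents are the classical case. An exponent [+oo] has inverse [0], so the other one
    must be [1]; two infinite exponents would give [0 = 1]. *)
Lemma hoelder_ge1 f g (p q : \bar R) :
    measurable_fun [set: T] f -> measurable_fun [set: T] g ->
    1 <= p -> 1 <= q -> p^-1 + q^-1 = 1 ->
  Lnorm mu 1 (EFin \o (f \* g)%R) <=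
  Lnorm mu p (EFin \o f) * Lnorm mu q (EFin \o g).
Proof.
move=> mf mg p1 q1 pq.
case: p p1 pq => // [p|] p1; case: q q1 => // [q|] q1.
- have p0 : (0 < p)%R by rewrite (lt_le_trans ltr01).
  have q0 : (0 < q)%R by rewrite (lt_le_trans ltr01).
  rewrite !inver !gt_eqF// => -[pq].
  exact: hoelder.
- rewrite invey adde0 => /eqP; rewrite inve_eq1 => /eqP ->.
  exact: hoelder1y.
- rewrite invey add0e => /eqP; rewrite inve_eq1 => /eqP ->.
  rewrite muleC; apply: le_trans (hoelder1y mg mf).
  by under eq_Lnorm do rewrite /= mulrC.
- by rewrite invey adde0 => /eqP; rewrite eq_sym onee_eq0.
Qed.

End Hoelder.

(* To be used with [h y = k (x, y)] for an integral kernel [k] and with [g] a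
   representative of [b *: phi], which need only agree with it a.e. *)
Lemma normc_cintegral_kernel_le d (T : measurableType d) (R : realType)
    (mu : {measure set T -> \bar R}) (h phi g rho : T -> R[i]) (b : R[i])
    (p q : \bar R) :
  cmeasurable h -> cmeasurable phi -> cmeasurable rho ->
  (forall y, rho y != 0) -> {ae mu, forall y, g y = b * phi y} ->
  cintegrable mu (fun y => h y * g y) ->
  (1 <= p)%E -> (1 <= q)%E -> (p^-1 + q^-1 = 1)%E ->
  ((normc (cintegral mu (fun y => h y * g y)%R))%:E <= (normc b)%:E
    * cLnorm mu p (fun y => (phi y / rho y)%R)
    * cLnorm mu q (fun y => (h y * rho y)%R))%E.
Proof.
move=> mh mphi mrho rho0 gE hg p1 q1 pq.
pose F y := normc (phi y / rho y); pose G y := normc (h y * rho y).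
have mF : measurable_fun [set: T] F.
  (* Inversion is written as the real power of exponent [-1], whose measurability is available. *)
  rewrite (_ : F = fun y => normc (phi y) * normc (rho y) `^ (-1)); last first.
    by apply/funext => y; rewrite powR_inv1 ?normc_ge0// -normcV -normcM.
  apply: measurable_funM; first exact: measurable_normc.
  apply: (measurableT_comp (measurable_powR (-1))); exact: measurable_normc.
have mG : measurable_fun [set: T] G.
  by apply: measurable_normc; exact: cmeasurableM.
have mFG : measurable_fun [set: T] (F \* G) by exact: measurable_funM.
(* The two factors [rho y] cancel because [rho] has no zero. *)
have hgE : {ae mu, forall y, normc (h y * g y) = normc b * (F y * G y)}.
  apply: filterS gE => y ->; rewrite /F /G -!normcM; congr normc.
  rewrite [h y * rho y]mulrC [phi y / rho y * _]mulrA divfK//.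
  by rewrite mulrCA [h y * _]mulrC.
have FG0 y : 0 <= F y * G y by rewrite mulr_ge0 ?normc_ge0.
have nhg := cintegrable_normc hg.
apply: (@le_trans _ _ (\int[mu]_y (normc (h y * g y))%:E)%E).
  rewrite -[leRHS]fineK; last exact: integrable_fin_num nhg.
  by rewrite lee_fin; exact: normc_cintegral_le.
(* The absolute value changes nothing, as [F y * G y] is nonnegative, but it exhibits the norm of
   exponent [1]. *)
apply: (@le_trans _ _ (\int[mu]_y ((normc b)%:E * `|(F y * G y)%:E|))%E).
  apply: ae_ge0_le_integral => //.
  - by move=> y _; rewrite lee_fin normc_ge0.
  - exact: measurable_int nhg.
  - by move=> y _; rewrite mule_ge0// lee_fin normc_ge0.
  - apply: emeasurable_funM => //; apply: measurableT_comp => //.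
    exact/measurable_EFinP.
  apply: filterS hgE => y -> _.
  by rewrite gee0_abs ?lee_fin// -EFinM.
rewrite ge0_integralZl ?lee_fin ?normc_ge0//; last first.
  by apply: measurableT_comp => //; exact/measurable_EFinP.
rewrite -muleA; apply: lee_wpmul2l; first by rewrite lee_fin normc_ge0.
have := hoelder_ge1 mu mF mG p1 q1 pq.
by rewrite Lnorm1.
Qed.

(** * Continuity of the real and imaginary parts *)

Section Continuity.
Context {R : realType}.

(** Such an [h] is Lipschitz with constant [1], so the tolerance itself serves as radius. *)
Lemma le_normc_continuous (h : R[i] -> R) : {morph h : z w / z - w} ->
  (forall z, `|h z| <= normc z) -> continuous (h : R[i]^o -> R).
Proof.
move=> hB hn z; have zF := @nbhs_filter (R[i]^o) z.
apply/(@cvgrPdist_lt _ _ _ (nbhs (z : R[i]^o)) zF) => e e0.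
apply/nbhs_ballP; exists e%:C%C => [|w]; first by rewrite /= ltcR.
rewrite /ball/= -[_ < _]/(`|z - w| < e%:C%C) normr_normc ltcR.
by apply: le_lt_trans; rewrite -hB.
Qed.

Lemma Re_continuous : continuous (@complex.Re R : R[i]^o -> R).
Proof.
apply: le_normc_continuous; last exact: normr_Re_le_normc.
by case=> a b [c e].
Qed.

Lemma Im_continuous : continuous (@complex.Im R : R[i]^o -> R).
Proof.
apply: le_normc_continuous; last exact: normr_Im_le_normc.
by case=> a b [c e].
Qed.

End Continuity.

(** * Pointwise bounds for fixed points of integral operators *)

Section IntegralOperators.
Context (R : realType).

Lemma cmeasurable_section d1 d2 (T1 : measurableType d1) (T2 : measurableType d2)
    (k : T1 * T2 -> R[i]) x : cmeasurable k -> cmeasurable (fun y => k (x, y)).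
Proof.
move=> [kr ki]; split; first exact: (measurable_fun_pair2 x kr).
exact: (measurable_fun_pair2 x ki).
Qed.

Section ContinuousVanishing.
Context d (X : measurableMetricType d R).
Hypothesis mopen : forall U : set X, open U -> measurable U.

(** Open rays generate the Borel sets of [R], and their preimages are open, hence measurable by
    [mopen]. *)
Lemma measurable_continuous (f : X -> R) : continuous f ->
  measurable_fun [set: X] f.
Proof.
move=> /continuousP cf mD.
apply: (measurability _ (RGenOInfty.measurableE R)) => //.
move=> _ [_ [x ->] <-]; rewrite setTI; apply: mopen; apply: cf.
exact: interval_open.
Qed.

Lemma cmeasurable_C0 (f : C0 X R) : cmeasurable f.
Proof.
have := valP f; rewrite inE => -[cf _].
split; apply: measurable_continuous => x.
- exact: (@continuous_comp _ _ _ f _ x (cf x) (@Re_continuous R (f x))).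
- exact: (@continuous_comp _ _ _ f _ x (cf x) (@Im_continuous R (f x))).
Qed.

Lemma C0_fixpoint_bound (m : {measure set X -> \bar R})
    (K : C0 X R -> C0 X R) (k : X * X -> R[i]) (phi : C0 X R)
    (rho : X -> R[i]) (b : R[i]) (p q : \bar R) :
  C0_integral_operator m K k -> K (b *: phi) = phi ->
  cmeasurable rho -> (forall y, rho y != 0) ->
  (1 <= p)%E -> (1 <= q)%E -> (p^-1 + q^-1 = 1)%E -> forall x,
  ((normc (phi x))%:E <= (normc b)%:E
    * cLnorm m p (fun y => (phi y / rho y)%R)
    * cLnorm m q (fun y => (k (x, y) * rho y)%R))%E.
Proof.
move=> [mk Kk] Kphi mrho rho0 p1 q1 pq x.
have [ik] := Kk (b *: phi) x; rewrite Kphi => phiE.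
(* Only [phi x] on the left becomes an integral; the norm on the right keeps [phi]. *)
rewrite [in leLHS]phiE.
apply: normc_cintegral_kernel_le => //.
- exact: cmeasurable_section.
- exact: cmeasurable_C0.
- exact: aeW.
Qed.

End ContinuousVanishing.

Lemma Lp_fixpoint_bound d (X : measurableType d) (m : {measure set X -> \bar R})
    (r : \bar R) (r1 : (1 <= r)%E) (K : cLp m r1 -> cLp m r1)
    (k : X * X -> R[i]) (phi : cLp m r1)
    (rho : X -> R[i]) (b : R[i]) (p q : \bar R) :
  Lp_integral_operator K k -> K (b *: phi) = phi ->
  cmeasurable rho -> (forall y, rho y != 0) ->
  (1 <= p)%E -> (1 <= q)%E -> (p^-1 + q^-1 = 1)%E ->
  {ae m, forall x, ((normc (phi x))%:E <= (normc b)%:E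
    * cLnorm m p (fun y => (phi y / rho y)%R)
    * cLnorm m q (fun y => (k (x, y) * rho y)%R))%E}.
Proof.
move=> [mk Kk] Kphi mrho rho0 p1 q1 pq.
(* [K (b *: phi)] and [phi] are equal classes, hence share their chosen representative; the
   exceptional set in [x] comes from the kernel formula alone. *)
apply: filterS (Kk (b *: phi)) => x [ik]; rewrite Kphi => phiE.
rewrite [in leLHS]phiE.
apply: normc_cintegral_kernel_le => //.
- exact: cmeasurable_section.
- exact: cLfun_measurable.
(* The representative of [b *: phi] agrees only almost everywhere with [b] times that of [phi]. *)
- by apply: filterS (cLp_fun_pi (b *: (repr phi : cLfun m r1))) => y ->.
Qed.

End IntegralOperators.

(** * Functions with vanishing right derivative *)

Section RightDerivative.
Context (R : realType) (V : normedModType R[i]).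
Implicit Types (u w : V) (v : R -> V).

(** The norm of [V] has values in [R[i]]. Being nonnegative it is real, so its real part allows
    comparisons within [R]. *)
Let nrm u : R := complex.Re `|u|.

Let nrmE u : `|u| = (nrm u)%:C%C.
Proof.
rewrite /nrm; have := normr_ge0 u; case: `|u| => a b /=.
by rewrite lecE/= => /andP[/eqP ->].
Qed.

Let nrm_ge0 u : 0 <= nrm u.
Proof. by rewrite -lecR -nrmE normr_ge0. Qed.

Let nrmD u w : nrm (u + w) <= nrm u + nrm w.
Proof. by rewrite -lecR rmorphD /= -!nrmE ler_normD. Qed.

Let nrm_cvg (F : set_system R) {FF : Filter F} v w : v x @[x --> F] --> w ->
  nrm (v x) @[x --> F] --> nrm w.
Proof.
move=> vw; apply/cvgrPdist_lt => e e0.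
have e0' : 0 < e%:C%C :> R[i] by rewrite ltcR.
move/cvgrPdist_lt : vw => /(_ _ e0'); apply: filterS => x.
rewrite nrmE ltcR; apply: le_lt_trans.
rewrite ler_norml lerNl opprB !lerBlDr; apply/andP; split.
  by have := nrmD (v x - w) w; rewrite subrK -[_ - w]opprB /nrm normrN.
by have := nrmD (w - v x) (v x); rewrite subrK.
Qed.

(* For every [e > 0], the supremum of the times [s <= T] such that
   [|v s - v 0| <= e * s] is such a time, and it cannot be below [T] because
   the right derivative vanishes there. *)
Lemma right_derive0_const v :
  {within `[0, +oo[, continuous v} ->
  (forall t, 0 <= t ->
    (h^-1)%:C%C *: (v (t + h) - v t) @[h --> (0 : R)^'+] --> (0 : V)) ->
  forall t, 0 <= t -> v t = v 0.
Proof.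
move=> /subspace_continuousP cv dv T T0.
pose g t := nrm (v t - v 0).
suff gle e : 0 < e -> g T <= e * T.
  have : g T <= 0.
    apply/ler_addgt0Pl => e e0; rewrite addr0.
    (* The slope [e / (T + 1)] also covers [T = 0]. *)
    have T1 : 0 < T + 1 by rewrite ltr_wpDl.
    apply: le_trans (gle (e / (T + 1)) _) _; first by rewrite divr_gt0.
    by rewrite mulrAC ler_pdivrMr// ler_pM2l// lerDl.
  move=> gT; apply/eqP; rewrite -subr_eq0 -normr_eq0 nrmE.
  have -> : nrm (v T - v 0) = 0 by apply/eqP; rewrite eq_le gT nrm_ge0.
  by [].
move=> e0; pose E := [set s | 0 <= s <= T /\ g s <= e * s].
have E0 : E 0 by split; [rewrite lexx|rewrite /g subrr /nrm normr0 mulr0].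
have Eub : ubound E T by move=> s [/andP[]].
have hubE : has_ubound E by exists T.
have hsE : has_sup E by split; [exists 0|].
set s := sup E.
have s0 : 0 <= s by exact: (ub_le_sup hubE E0).
have sT : s <= T by apply: ge_sup => //; exists 0.
(* Otherwise continuity gives [g x > e * x] at all [x >= 0] near [s], but [E] has points arbitrarily
   close to its supremum. *)
have Es : g s <= e * s.
  rewrite leNgt; apply/negP => gs.
  have cg : g x - e * x @[x --> within `[0, +oo[%classic (nbhs s)] --> g s - e * s.
    apply: cvgB; last first.
      apply: cvg_within_filter; apply: cvgMr; exact: cvg_id.
    apply: nrm_cvg; apply: cvgB; last exact: cvg_cst.
    by apply: cv; rewrite /= in_itv/= s0.
  have gs0 : 0 < g s - e * s by rewrite subr_gt0.
  have := cvgr_gt _ cg _ gs0; rewrite near_withinE => near_s.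
  have /nbhs_ballP[d /= d0 dP] :
      nbhs s (fun x => `[0, +oo[%classic x -> 0 < g x - e * x).
    exact: near_s.
  have [x Ex xs] := sup_adherent d0 hsE.
  have xles : x <= s by exact: (ub_le_sup hubE Ex).
  case: Ex => /andP[x0 _]; apply/negP; rewrite -ltNge -subr_gt0.
  apply: dP; last by rewrite /= in_itv/= x0.
  rewrite /ball/= ger0_norm ?subr_ge0// ltrBlDr -ltrBlDl.
  exact: xs.
have [sltT|] := ltP s T; last by move=> Ts; have -> : T = s by apply/le_anti/andP.
have e0' : 0 < e%:C%C :> R[i] by rewrite ltcR.
have /cvgrPdist_lt/(_ _ e0') := dv s s0.
move=> near1.
have near2 : \forall h \near (0 : R)^'+, h < T - s.
  by apply: nbhs_right_lt; rewrite subr_gt0.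
have near3 := nbhs_right_gt (0 : R).
(* A positive [h] that keeps [s + h] below [T] and makes the difference quotient at [s] smaller than
   [e] in norm. *)
have [h [[h1 h2] h3]] := filter_ex (filterI (filterI near1 near2) near3).
(* The increment of [v] over this step is at most [e * h]; added to [Es], it puts a point beyond [s]
   in [E]. *)
have : E (s + h).
  split; first by rewrite addr_ge0 ?(ltW h3)//= -lerBrDl ltW.
  have := nrmD (v (s + h) - v s) (v s - v 0); rewrite addrA subrK => /le_trans.
  apply; rewrite mulrDr addrC lerD// -lecR -nrmE.
  move: h1; rewrite sub0r normrN normrZ normr_normc.
  have -> : normc (h^-1%:C)%C = h^-1.
    by rewrite /= expr0n addr0 sqrtr_sqr gtr0_norm// invr_gt0.
  by rewrite nrmE -rmorphM/= ltcR lecR mulrC ltr_pdivrMr// => /ltW.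
by move=> /(ub_le_sup hubE); rewrite -/s leNgt ltrDl h3.
Qed.

End RightDerivative.

(** * The complex exponential and its derivative along a line through the origin *)

Section ComplexExponential.
Context {R : realType}.
Local Open Scope complex_scope.
Implicit Types z w : R[i].

Definition cexp z : R[i] :=
  (expR (complex.Re z) * cos (complex.Im z)) +i*
  (expR (complex.Re z) * sin (complex.Im z)).

Lemma cexp0 : cexp 0 = 1.
Proof. by rewrite /cexp /= expR0 cos0 sin0 mulr1 mulr0. Qed.

Lemma cexpD z w : cexp (z + w) = cexp z * cexp w.
Proof.
case: z w => a b [c e]; rewrite /cexp /= expRD cosD sinD.
by apply/eqP; rewrite eq_complex /=; apply/andP; split; apply/eqP; ring.
Qed.

Lemma normc_cexp z : normc (cexp z) = expR (complex.Re z).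
Proof.
rewrite /cexp /= !exprMn -mulrDr cos2Dsin2 mulr1 sqrtr_sqr.
by rewrite ger0_norm ?expR_ge0.
Qed.

Lemma normc_cexp_scale (t : R) z :
  normc (cexp (t%:C * z)) = expR (t * complex.Re z).
Proof. by rewrite normc_cexp; case: z => a b /=; rewrite mul0r subr0. Qed.

Lemma cvg_complex (T : Type) (F : set_system T) (FF : Filter F)
    (f g : T -> R) (l m : R) :
  f x @[x --> F] --> l -> g x @[x --> F] --> m ->
  (f x +i* g x : R[i]^o) @[x --> F] --> (l +i* m : R[i]^o).
Proof.
move=> /cvgrPdist_lt fl /cvgrPdist_lt gm; apply/cvgrPdist_lt => -[e e'].
(* A positive tolerance in [R[i]] is real; each component gets half of it. *)
rewrite ltcE /= => /andP[/eqP -> e0].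
have e2 : 0 < e / 2 by rewrite divr_gt0.
apply: filterS2 (fl _ e2) (gm _ e2) => x fx gx.
rewrite normr_normc ltcR [e]splitr.
by apply: le_lt_trans (normc_leD _) _ => /=; rewrite ltrD.
Qed.

Let Re_cexp (a b t : R) : R := expR (a * t) * cos (b * t).
Let Im_cexp (a b t : R) : R := expR (a * t) * sin (b * t).

Let cexpE a b t : cexp (t%:C * (a +i* b)) = Re_cexp a b t +i* Im_cexp a b t.
Proof.
by rewrite /cexp /= !mul0r subr0 addr0 /Re_cexp /Im_cexp ![t * _]mulrC.
Qed.

Let is_derive_scale (a t : R) : is_derive t 1 (fun x => a * x) a.
Proof.
have := is_deriveZ a (is_derive_id t (1 : R)).
by rewrite /GRing.scale /= mulr1.
Qed.

Let is_derive_Re (a b t : R) : is_derive t 1 (Re_cexp a b)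
  (a * Re_cexp a b t - b * Im_cexp a b t).
Proof.
have /is_deriveM := is_derive1_comp (is_derive_expR _) (is_derive_scale a t).
move=> /(_ _ _ (is_derive1_comp (is_derive_cos _) (is_derive_scale b t))) => dM.
apply: (is_derive_eq dM); rewrite /Re_cexp /Im_cexp /GRing.scale /=; ring.
Qed.

Let is_derive_Im (a b t : R) : is_derive t 1 (Im_cexp a b)
  (a * Im_cexp a b t + b * Re_cexp a b t).
Proof.
have /is_deriveM := is_derive1_comp (is_derive_expR _) (is_derive_scale a t).
move=> /(_ _ _ (is_derive1_comp (is_derive_sin _) (is_derive_scale b t))) => dM.
apply: (is_derive_eq dM); rewrite /Re_cexp /Im_cexp /GRing.scale /=; ring.
Qed.

Lemma is_derive_continuous (f : R -> R) (t d : R) : is_derive t 1 f d ->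
  {for t, continuous f}.
Proof.
by move=> [df _]; apply: differentiable_continuous; apply/derivable1_diffP.
Qed.

(** The filter [0^'+] refines the punctured neighbourhoods [0^'] that define the derivative. *)
Lemma is_derive_right (f : R -> R) (t d : R) : is_derive t 1 f d ->
  h^-1 * (f (t + h) - f t) @[h --> 0^'+] --> d.
Proof.
move=> [df <-].
have cf : h^-1 * (f (t + h) - f t) @[h --> 0^'] --> 'D_1 f t.
  have E : (fun h => h^-1 * (f (t + h) - f t)) =
      (fun h => h^-1 *: (f (h *: 1 + t) - f t)).
    by apply/funext => h; rewrite /GRing.scale /= mulr1 [h + t]addrC.
  by rewrite E; exact: df.
apply: cvg_trans cf; apply: cvg_app; apply: within_subset => x /= x0.
by rewrite gt_eqF.
Qed.

Lemma cexp_continuous z : continuous (fun t : R => cexp (t%:C * z) : R[i]^o).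
Proof.
case: z => a b t; rewrite /continuous_at (funext (cexpE a b)).
rewrite cexpE; apply: cvg_complex.
- exact: (is_derive_continuous (is_derive_Re a b t)).
- exact: (is_derive_continuous (is_derive_Im a b t)).
Qed.

(** At [0] the two components have derivatives [a * 1 - b * 0] and [a * 0 + b * 1]. *)
Lemma cexp_right_derive0 z :
  (h^-1%:C * (cexp (h%:C * z) - 1) : R[i]^o) @[h --> (0 : R)^'+] --> (z : R[i]^o).
Proof.
case: z => a b.
have Re0 : Re_cexp a b 0 = 1 by rewrite /Re_cexp !mulr0 expR0 cos0 mulr1.
have Im0 : Im_cexp a b 0 = 0 by rewrite /Im_cexp !mulr0 sin0 mulr0.
have E h : h^-1%:C * (cexp (h%:C * (a +i* b)) - 1) =
    (h^-1 * (Re_cexp a b (0 + h) - Re_cexp a b 0)) +i*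
    (h^-1 * (Im_cexp a b (0 + h) - Im_cexp a b 0)).
  rewrite cexpE add0r Re0 Im0.
  apply/eqP; rewrite eq_complex /=; apply/andP; split; apply/eqP; ring.
rewrite (funext E).
apply: cvg_complex.
- have := is_derive_right (is_derive_Re a b 0).
  by rewrite Re0 Im0 mulr1 mulr0 subr0.
- have := is_derive_right (is_derive_Im a b 0).
  by rewrite Re0 Im0 mulr1 mulr0 add0r.
Qed.

End ComplexExponential.

(** * Eigenvectors under a strongly continuous semigroup *)

Section Semigroup.
Context (R : realType) (V : normedModType R[i]).
Local Open Scope complex_scope.
Implicit Types (A : operator V) (S : R -> V -> V).

(* The right derivative of [s |-> e^(s lambda) S s phi] at [s] is the image
   under [e^(s lambda) S s] of its right derivative at [0], which vanishes.
   Only the continuity of each single [S s] is needed, not a uniform bound. *)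
Lemma semigroup_eigenvector A S (lambda : R[i]) (phi : V) (t : R) :
  generates (op_opp A) S -> eigenpair A lambda phi -> 0 <= t ->
  S t (cexp (t%:C * lambda) *: phi) = phi.
Proof.
move=> [[SL S0 SD Sc] gen] [_ dphi Aphi] t0.
have SZ s a u : 0 <= s -> S s (a *: u) = a *: S s u.
  move=> s0; have [L _] := SL s s0.
  have S00 : S s 0 = 0.
    by apply: (addrI (1 *: S s 0)); rewrite -L scaler0 addr0 addr0 scale1r.
  by rewrite -[a *: u]addr0 L S00 addr0.
have SB s u w : 0 <= s -> S s (u - w) = S s u - S s w.
  by move=> s0; have [L _] := SL s s0; rewrite addrC -scaleN1r L scaleN1r addrC.
pose v s := cexp (s%:C * lambda) *: S s phi.
rewrite SZ//; transitivity (v 0); last by rewrite /v mul0r cexp0 scale1r S0.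
apply: (@right_derive0_const _ _ v) => // [|s s0].
  apply/subspace_continuousP => s s0.
  apply: cvgZ; last by have /subspace_continuousP := Sc phi; apply.
  by apply: cvg_within_filter; exact: (@cexp_continuous _ lambda s).
have S_cvg : S h phi @[h --> (0 : R)^'+] --> phi.
  have : S h phi @[h --> within `[0, +oo[%classic (nbhs (0 : R))] --> S 0 phi.
    have /subspace_continuousP := Sc phi; apply.
    by rewrite /= in_itv/= lexx.
  rewrite S0; apply: cvg_trans; apply: cvg_app; apply: within_subset => x /= x0.
  by rewrite in_itv/= ltW.
(* The difference quotient at [0] of [v]. By the product rule [wE], the exponential contributes
   [lambda *: phi] and the generator [- (lambda *: phi)]. *)
pose w h := h^-1%:C *: (cexp (h%:C * lambda) *: S h phi - phi).
have w_cvg : w h @[h --> (0 : R)^'+] --> (0 : V).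
  have /gen : graph (op_opp A) (phi, - (lambda *: phi)).
    by split => //=; rewrite Aphi.
  have wE h : w h = (h^-1%:C * (cexp (h%:C * lambda) - 1)) *: S h phi +
      h^-1%:C *: (S h phi - phi).
    rewrite -scalerA -scalerDr /w; congr (_ *: _).
    by rewrite scalerBl scale1r addrA subrK.
  rewrite (funext wE) -[X in _ -> _ --> X](subrr (lambda *: phi)); apply: cvgD.
  by apply: cvgZ S_cvg; exact: cexp_right_derive0.
have [L cS] := SL s s0.
have : cexp (s%:C * lambda) *: S s (w h) @[h --> (0 : R)^'+] -->
    cexp (s%:C * lambda) *: S s 0.
  by apply: cvgZr; apply: (cvg_comp _ _ w_cvg); exact: cS.
have S00 : S s 0 = 0 by rewrite -(subrr phi) SB// !subrr.
(* For [h > 0] the semigroup law identifies the difference quotient of [v] at [s] with the image of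
   [w h]. *)
rewrite S00 scaler0; apply: cvg_trans; apply: near_eq_cvg.
near=> h; have h0 : 0 < h by near: h; exact: nbhs_right_gt.
rewrite /v SD ?(ltW h0)//.
rewrite /w /= SZ// SB// SZ// rmorphD mulrDl cexpD.
by rewrite scalerA [_ * (h^-1)%:C]mulrC -[LHS]scalerA scalerBr scalerA.
Unshelve. all: by end_near.
Qed.

End Semigroup.

(** * Eigenvectors under the resolvent *)

Section Eigenvectors.
Context (R : realType) (V : normedModType R[i]).
Implicit Type A : operator V.

(** [mu + A] multiplies [phi] by [lambda + mu], and [B] undoes this. The scalar stays inside [B] to
    avoid dividing by [lambda + mu]. *)
Lemma resolvent_eigenvector A (mu lambda : R[i]) (B : V -> V) (phi : V) :
  op_inverse (op_shift mu A) B -> eigenpair A lambda phi ->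
  B ((lambda + mu) *: phi) = phi.
Proof.
move=> [_ BA] [_ dphi Aphi].
by have := BA phi dphi; rewrite /= Aphi -scalerDl addrC.
Qed.

End Eigenvectors.

Theorem proposition3p10 (R : realType) :
  (forall (d : measure_display) (X : measurableMetricType d R)
      (m : {measure set X -> \bar R}) (A : operator (C0 X R)) (rho : X -> R[i])
      (lambda : R[i]) (phi : C0 X R),
    locally_compact [set: X] ->
    (forall U : set X, open U -> measurable U) ->
    closed_operator A ->
    cmeasurable rho -> (forall x, rho x != 0) ->
    eigenpair A lambda phi ->
    (forall (mu : R[i]) (B : C0 X R -> C0 X R) (k : X * X -> R[i]),
      op_inverse (op_shift mu A) B -> C0_integral_operator m B k ->
      forall r1 r2 : \bar R, (1 <= r1)%E -> (1 <= r2)%E ->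
        (r1^-1 + r2^-1 = 1)%E ->
      forall x : X,
        (cLnorm m r1 (fun y => (phi y / rho y)%R) < +oo)%E ->
        (cLnorm m r2 (fun y => (k (x, y) * rho y)%R) < +oo)%E ->
        ((normc (phi x))%:E <= (normc (lambda + mu))%:E
          * cLnorm m r1 (fun y => (phi y / rho y)%R)
          * cLnorm m r2 (fun y => (k (x, y) * rho y)%R))%E)
    /\
    (forall (S : R -> C0 X R -> C0 X R) (t0 : R) (k : X * X -> R[i]),
      generates (op_opp A) S -> 0 < t0 -> C0_integral_operator m (S t0) k ->
      forall r1 r2 : \bar R, (1 <= r1)%E -> (1 <= r2)%E ->
        (r1^-1 + r2^-1 = 1)%E ->
      forall x : X,
        (cLnorm m r1 (fun y => (phi y / rho y)%R) < +oo)%E ->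
        (cLnorm m r2 (fun y => (k (x, y) * rho y)%R) < +oo)%E ->
        ((normc (phi x))%:E <= (expR (t0 * complex.Re lambda))%:E
          * cLnorm m r1 (fun y => (phi y / rho y)%R)
          * cLnorm m r2 (fun y => (k (x, y) * rho y)%R))%E))
  /\
  (forall (d : measure_display) (X : measurableType d)
      (m : {measure set X -> \bar R}) (q : \bar R) (q1 : (1 <= q)%E)
      (A : operator (cLp m q1)) (rho : X -> R[i])
      (lambda : R[i]) (phi : cLp m q1),
    closed_operator A ->
    cmeasurable rho -> (forall x, rho x != 0) ->
    eigenpair A lambda phi ->
    (forall (mu : R[i]) (B : cLp m q1 -> cLp m q1) (k : X * X -> R[i]),
      op_inverse (op_shift mu A) B -> Lp_integral_operator B k ->
      forall r1 r2 : \bar R, (1 <= r1)%E -> (1 <= r2)%E ->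
        (r1^-1 + r2^-1 = 1)%E ->
      {ae m, forall x : X,
        (cLnorm m r1 (fun y => (phi y / rho y)%R) < +oo)%E ->
        (cLnorm m r2 (fun y => (k (x, y) * rho y)%R) < +oo)%E ->
        ((normc (phi x))%:E <= (normc (lambda + mu))%:E
          * cLnorm m r1 (fun y => (phi y / rho y)%R)
          * cLnorm m r2 (fun y => (k (x, y) * rho y)%R))%E})
    /\
    (forall (S : R -> cLp m q1 -> cLp m q1) (t0 : R) (k : X * X -> R[i]),
      generates (op_opp A) S -> 0 < t0 -> Lp_integral_operator (S t0) k ->
      forall r1 r2 : \bar R, (1 <= r1)%E -> (1 <= r2)%E ->
        (r1^-1 + r2^-1 = 1)%E ->
      {ae m, forall x : X,
        (cLnorm m r1 (fun y => (phi y / rho y)%R) < +oo)%E ->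
        (cLnorm m r2 (fun y => (k (x, y) * rho y)%R) < +oo)%E ->
        ((normc (phi x))%:E <= (expR (t0 * complex.Re lambda))%:E
          * cLnorm m r1 (fun y => (phi y / rho y)%R)
          * cLnorm m r2 (fun y => (k (x, y) * rho y)%R))%E})).
Proof.
split=> [d X m A rho lambda phi _ mopen _ mrho rho0 eig|
         d X m q q1 A rho lambda phi _ mrho rho0 eig]; split.
- move=> mu B k invB kB r1 r2 r1_ge1 r2_ge1 r12 x _ _.
  exact: (C0_fixpoint_bound mopen kB (resolvent_eigenvector invB eig)).
- move=> S t0 k genS t0_gt0 kS r1 r2 r1_ge1 r2_ge1 r12 x _ _.
  have fixS := semigroup_eigenvector genS eig (ltW t0_gt0).
  (* The scalar is [cexp (t0%:C * lambda)], whose modulus is the real exponential in the claim. *)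
  by have := C0_fixpoint_bound mopen kS fixS mrho rho0 r1_ge1 r2_ge1 r12 x;
    rewrite normc_cexp_scale.
- move=> mu B k invB kB r1 r2 r1_ge1 r2_ge1 r12.
  apply: filterS (Lp_fixpoint_bound kB (resolvent_eigenvector invB eig)
    mrho rho0 r1_ge1 r2_ge1 r12) => x phix _ _.
  exact: phix.
- move=> S t0 k genS t0_gt0 kS r1 r2 r1_ge1 r2_ge1 r12.
  have fixS := semigroup_eigenvector genS eig (ltW t0_gt0).
  apply: filterS (Lp_fixpoint_bound kS fixS
    mrho rho0 r1_ge1 r2_ge1 r12) => x + _ _.
  by rewrite normc_cexp_scale.
Qed.
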